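(* Let $I\subseteq\mathbb{R}$ be an open interval and let $(\mathbf{r},\mathbf{e})$, with $\mathbf{r}:I\to\mathbb{R}^5\setminus\{0\}$ and $\mathbf{e}=(e^1,e^2,e^3):I\to\mathbb{R}^3$, be a solution to the Poincaré problem in $\mathbb{R}^5\setminus\{0\}$ (see context); let $(\mathbf{u},r):I\to\mathbb{R}^4\times\mathbb{R}^+$ be the expression of $\mathbf{r}$ in stereographic coordinates, and $\mathbf{A},\mathbf{E}$ the associated matrices. If $\mathbf{r}$ is non-colliding, then $\mathbf{r}$ is a geodesic on the $4$-dimensional cone in $\mathbb{R}^5$ directed along the constant (independent of $t\in I$) vector $$\mathbf{L}:=\left(\frac{\bigl(|\mathbf{e}|^2-4r^2(\mathbf{A}\dot{\mathbf{u}}\cdot\mathbf{e})\bigr)\mathbf{u}+2r^2\,\mathbf{E}\dot{\mathbf{u}}}{2(|\mathbf{u}|^2+1)},\ \frac{2r^2(\mathbf{A}\dot{\mathbf{u}}\cdot\mathbf{e})}{|\mathbf{u}|^2+1}+\frac{|\mathbf{e}|^2}{4}\,\frac{|\mathbf{u}|^2-1}{|\mathbf{u}|^2+1}\right)\in\mathbb{R}^4\times\mathbb{R}=\mathbb{R}^5$$ and of aperture $\psi$ given by $$\cos\psi=\frac{|\mathbf{e}|}{2}\left(\frac{|\mathbf{e}|^2}{4}+\frac{4r^4|\dot{\mathbf{u}}|^2}{(|\mathbf{u}|^2+1)^2}\right)^{-1/2}.$$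
   Context: Write $\mathbb{R}^+=(0,\infty)$; dots denote $d/dt$; vectors are column vectors and $\cdot$, $|\cdot|$ are the Euclidean inner product and norm. Stereographic coordinates (from the north pole) on $\mathbb{R}^5\setminus\{0\}$ minus the positive $x_5$-axis: $(\mathbf{u},r)\in\mathbb{R}^4\times\mathbb{R}^+$, $\mathbf{u}=(u_1,u_2,u_3,u_4)$, corresponds to the point $$\mathbf{r}=\left(\frac{2r\mathbf{u}}{|\mathbf{u}|^2+1},\ r\,\frac{|\mathbf{u}|^2-1}{|\mathbf{u}|^2+1}\right)\in\mathbb{R}^4\times\mathbb{R}=\mathbb{R}^5,$$ so that $r=|\mathbf{r}|$. Matrices: for $\mathbf{u}\in\mathbb{R}^4$ and $\mathbf{e}=(e^1,e^2,e^3)\in\mathbb{R}^3$ (superscripts are indices), $$\mathbf{A}=\frac{1}{|\mathbf{u}|^2+1}\begin{pmatrix}-u_2&u_1&u_4&-u_3\\-u_3&-u_4&u_1&u_2\\-u_4&u_3&-u_2&u_1\end{pmatrix},\qquad \mathbf{E}=\begin{pmatrix}0&e^1&e^2&e^3\\-e^1&0&-e^3&e^2\\-e^2&e^3&0&-e^1\\-e^3&-e^2&e^1&0\end{pmatrix}.$$ Let $\mathbf{A}_1,\mathbf{A}_2,\mathbf{A}_3$ be the rows of $\mathbf{A}$, $B_i=\mathbf{A}_i\cdot\dot{\mathbf{u}}$, and $$\mathbf{B}=\begin{pmatrix} 0 & -B_3 & B_2 \\ B_3 & 0 & -B_1 \\ -B_2 & B_1 & 0 \end{pmatrix}.$$ Poincaré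 problem in $\mathbb{R}^5\setminus\{0\}$ (motion of a charged particle in the field of Yang's $\mathrm{SU}(2)$ monopole): $(\mathbf{r},\mathbf{e})$ is a solution if the curve $(\mathbf{u},r):I\to\mathbb{R}^4\times\mathbb{R}^+$ obtained by expressing $\mathbf{r}$ in the stereographic coordinates above (so $\mathbf{r}$ stays off the positive $x_5$-axis), together with $\mathbf{e}$, satisfies for all $t\in I$ $$\ddot{\mathbf{u}}+\frac{2|\dot{\mathbf{u}}|^2\mathbf{u}-4(\mathbf{u}\cdot\dot{\mathbf{u}})\dot{\mathbf{u}}}{|\mathbf{u}|^2+1}+\frac{2\dot r\dot{\mathbf{u}}}{r}=\frac{\mathbf{E}\dot{\mathbf{u}}}{2r^2},\qquad \ddot r-\frac{4r|\dot{\mathbf{u}}|^2}{(|\mathbf{u}|^2+1)^2}=0,\qquad \dot{\mathbf{e}}+2\mathbf{B}\mathbf{e}=0.$$ The last equation implies that $|\mathbf{e}|$ is constant. Colliding: a curve $\mathbf{r}:I\to\mathbb{R}^n\setminus\{0\}$ is colliding if $\dot{\mathbf{r}}(t)$ is parallel to $\mathbf{r}(t)$ (a scalar multiple of it, possibly zero) for every $t\in I$; otherwise it is non-colliding. Cone: the ($4$-dimensional) cone in $\mathbb{R}^5$ of aperture $\psi\in(0,\pi/2]$ directed along $\mathbf{L}\in\mathbb{R}^5\setminus\{0\}$ is the set of all $\mathbf{x}\in\mathbb{R}^5\setminus\{0\}$ with $\frac{\mathbf{x}\cdot\mathbf{L}}{|\mathbf{x}||\mathbf{L}|}=\cos\psi$.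 Geodesic: a geodesic on a cone $C$ is a differentiable curve $\mathbf{r}:I\to\mathbb{R}^5\setminus\{0\}$ with $\mathbf{r}(I)\subseteq C$ and $\frac{D}{dt}\dot{\mathbf{r}}(t)=0$ for all $t\in I$, where $\frac{D}{dt}$ is the covariant derivative of the metric on $C$ induced from Euclidean space (equivalently, the component of $\ddot{\mathbf{r}}$ tangent to $C$ vanishes). It need not be parametrized by arclength. *)

(* Defs.v *)
From HB Require Import structures.
From mathcomp Require Import all_boot all_order all_algebra.
From mathcomp Require Import all_classical all_reals all_analysis.

Set Implicit Arguments.
Unset Strict Implicit.
Unset Printing Implicit Defensive.

Import Order.TTheory GRing.Theory Num.Theory.
Import numFieldNormedType.Exports.

Local Open Scope ring_scope.
Local Open Scope classical_set_scope.

(* The library norm `|_| on matrices is the sup norm, hence the separate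
   Euclidean inner product and norm. It induces the same topology, so
   derivable and derive1 are the usual notions for curves in R^n. *)
Definition dot (R : realType) (n : nat) (v w : 'cV[R]_n) : R :=
  \sum_(i < n) v i 0 * w i 0.

Definition enorm (R : realType) (n : nat) (v : 'cV[R]_n) : R :=
  Num.sqrt (dot v v).

Definition mx_of_rows (R : realType) (m n : nat) (rows : seq (seq R)) :
    'M[R]_(m, n) :=
  \matrix_(i < m, j < n) (nth [::] rows i)`_j.

(* The point (v, a) of R^4 x R = R^5. *)
Definition pair5 (R : realType) (v : 'cV[R]_4) (a : R) : 'cV[R]_5 :=
  col_mx v (a%:M : 'cV[R]_1).

Definition stereo (R : realType) (u : 'cV[R]_4) (r : R) : 'cV[R]_5 :=
  pair5 ((2 * r / (enorm u ^+ 2 + 1)) *: u)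
        (r * ((enorm u ^+ 2 - 1) / (enorm u ^+ 2 + 1))).

(* Row and column indices start at 0 here: u_k is u (k - 1) 0. *)
Definition Amx (R : realType) (u : 'cV[R]_4) : 'M[R]_(3, 4) :=
  let u1 := u 0 0 in let u2 := u 1 0 in
  let u3 := u 2%:R 0 in let u4 := u 3%:R 0 in
  (enorm u ^+ 2 + 1)^-1 *: mx_of_rows 3 4
    [:: [:: - u2;   u1;   u4; - u3];
        [:: - u3; - u4;   u1;   u2];
        [:: - u4;   u3; - u2;   u1]].

Definition Emx (R : realType) (e : 'cV[R]_3) : 'M[R]_4 :=
  let e1 := e 0 0 in let e2 := e 1 0 in let e3 := e 2%:R 0 in
  mx_of_rows 4 4
    [:: [::    0;   e1;   e2;   e3];
        [:: - e1;    0; - e3;   e2];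
        [:: - e2;   e3;    0; - e1];
        [:: - e3; - e2;   e1;    0]].

(* du stands for the velocity of u. *)
Definition Bmx (R : realType) (u du : 'cV[R]_4) : 'M[R]_3 :=
  let b := Amx u *m du in
  let b1 := b 0 0 in let b2 := b 1 0 in let b3 := b 2%:R 0 in
  mx_of_rows 3 3
    [:: [::    0; - b3;   b2];
        [::   b3;    0; - b1];
        [:: - b2;   b1;    0]].

(* Curves on I are total functions on R of which only the restriction to I
   matters; I is open wherever derivatives are taken. *)

(* (u, r) is the expression of x in stereographic coordinates. *)
Definition stereo_expression (R : realType) (I : set R)
    (x : R -> 'cV[R]_5) (u : R -> 'cV[R]_4) (r : R -> R) : Prop :=
  forall t, I t -> 0 < r t /\ x t = stereo (u t) (r t).

Definition poincare_equations (R : realType) (I : set R)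
    (u : R -> 'cV[R]_4) (r : R -> R) (e : R -> 'cV[R]_3) : Prop :=
  forall t, I t ->
  [/\ [/\ derivable u t 1, derivable (derive1 u) t 1,
          derivable r t 1, derivable (derive1 r) t 1 & derivable e t 1],
      derive1n 2 u t
      + (enorm (u t) ^+ 2 + 1)^-1 *:
          ((2 * enorm (derive1 u t) ^+ 2) *: u t
           - (4 * dot (u t) (derive1 u t)) *: derive1 u t)
      + (2 * derive1 r t / r t) *: derive1 u t
      = (2 * r t ^+ 2)^-1 *: (Emx (e t) *m derive1 u t),
      derive1n 2 r t
      - 4 * r t * enorm (derive1 u t) ^+ 2 / (enorm (u t) ^+ 2 + 1) ^+ 2 = 0
    & derive1 e t + 2 *: (Bmx (u t) (derive1 u t) *m e t) = 0].

(* (x, e) solves the Poincare problem, x being expressed as (u, r). The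
   coordinates u and r are uniquely determined by x on I. *)
Definition poincare_solution (R : realType) (I : set R)
    (x : R -> 'cV[R]_5) (e : R -> 'cV[R]_3)
    (u : R -> 'cV[R]_4) (r : R -> R) : Prop :=
  stereo_expression I x u r /\ poincare_equations I u r e.

Definition colliding (R : realType) (n : nat) (I : set R)
    (x : R -> 'cV[R]_n.+1) : Prop :=
  forall t, I t -> exists c : R, derive1 x t = c *: x t.

(* For L = 0 the quotient is 0 by the convention a / 0 = 0, so that
   cone 0 (pi / 2) is the whole punctured space. *)
Definition cone (R : realType) (n : nat) (L : 'cV[R]_n) (psi : R) :
    set 'cV[R]_n :=
  [set x | x != 0 /\ dot x L / (enorm x * enorm L) = cos psi].

(* v is the velocity at x of a curve in C; when C is an embedded submanifold
   this is the tangent space of C at x. *)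
Definition tangent_vector (R : realType) (n : nat) (C : set 'cV[R]_n.+1)
    (x v : 'cV[R]_n.+1) : Prop :=
  exists g : R -> 'cV[R]_n.+1,
    [/\ g 0 = x, \forall s \near (0 : R), C (g s),
        derivable g 0 1 & derive1 g 0 = v].

(* Vanishing covariant derivative of the velocity, for the metric induced on
   C: the component of the acceleration tangent to C is zero. *)
Definition geodesic_on (R : realType) (n : nat) (C : set 'cV[R]_n.+1)
    (I : set R) (x : R -> 'cV[R]_n.+1) : Prop :=
  forall t, I t ->
  [/\ C (x t), derivable x t 1, derivable (derive1 x) t 1
    & forall v, tangent_vector C (x t) v -> dot (derive1n 2 x t) v = 0].

(* du stands for the velocity of u. *)
Definition Lvec (R : realType) (u du : 'cV[R]_4) (r : R) (e : 'cV[R]_3) :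
    'cV[R]_5 :=
  pair5
    ((2 * (enorm u ^+ 2 + 1))^-1 *:
       ((enorm e ^+ 2 - 4 * r ^+ 2 * dot (Amx u *m du) e) *: u
        + (2 * r ^+ 2) *: (Emx e *m du)))
    (2 * r ^+ 2 * dot (Amx u *m du) e / (enorm u ^+ 2 + 1)
     + enorm e ^+ 2 / 4 * ((enorm u ^+ 2 - 1) / (enorm u ^+ 2 + 1))).

Definition cos_aperture (R : realType) (u du : 'cV[R]_4) (r : R)
    (e : 'cV[R]_3) : R :=
  enorm e / 2 *
  (Num.sqrt (enorm e ^+ 2 / 4
             + 4 * r ^+ 4 * enorm du ^+ 2 / (enorm u ^+ 2 + 1) ^+ 2))^-1.

(* Main.v *)
Require Import Defs.
From mathcomp Require Import all_boot all_order all_algebra.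
From mathcomp Require Import all_classical all_reals all_analysis.
From mathcomp Require Import ring lra.
Import Order.TTheory GRing.Theory Num.Theory.
Import numFieldNormedType.Exports.
Local Open Scope ring_scope.
Local Open Scope classical_set_scope.

Set Implicit Arguments.
Unset Strict Implicit.
Unset Printing Implicit Defensive.

(** Put xi(u) = stereo u 1, a point of the unit sphere S^4, and write N for
    |u|^2 + 1. The differential of xi at u is w |-> dstereo u w: it multiplies
    Euclidean lengths by 2 / N and takes its values orthogonally to xi(u). The
    curve is x = r xi(u).

    The quadratic terms in u' of the equation for u are the Christoffel terms
    of the round metric, so by the Gauss formula of S^4 (is_derive_dstereo)
    the equations for u and r say exactly that
      x'' = dxi (E u') / (2 r)                           (is_derive_dx).
    In the same language, with c = |e|^2 / 4, the vector of the theorem is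
      L = c xi + (r^2 / 2) dxi (E u')                    (Lvec_dstereo).
    Hence xi . L = c and x'' = r^-3 (L - c x / |x|): the acceleration is normal
    to the hypersurface x . L = c |x|, which is the cone of the theorem.

    That L is constant (is_derive_Lvec) holds because the equation for e makes
    the field of endomorphisms E parallel along u for the round metric: the
    change of E compensates the failure of E to commute with the Christoffel
    terms (Emx_Bmx). The covariant derivative of E u' is then E applied to the
    covariant acceleration of u, and as E^2 = - |e|^2 the derivative of the
    second term of L is - c xi', the opposite of that of the first.

    The aperture needs two more constants: |e|, because e' is orthogonal to e,
    and the squared angular momentum lambda2 = r^4 |xi'|^2, because the force
    is orthogonal to the velocity and the Coriolis term 2 r' u' / r absorbs the
    change of r. Since E is antisymmetric with E^2 = - |e|^2, one gets
    |L|^2 = c (c + lambda2) (dot_Lvec), and c / |L| is the prescribed cosine.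
    Non-collision gives u' <> 0 at one time, hence lambda2 > 0 at all times:
    the cosine lies in [0, 1) and the cone is not reduced to a ray. If e = 0
    then L = 0 and x'' = 0, in agreement with the convention on cone 0. *)

(** * Derivatives of curves in spaces of column vectors *)

Section Calculus.
Context {R : realType}.
Implicit Types (t : R) (I : set R).

(** All vector-valued product rules below are reduced to scalar ones
    through this characterization. *)
Lemma is_derive_mxP m n t (f : R -> 'M[R]_(m, n)) (df : 'M[R]_(m, n)) :
  is_derive t 1 f df <-> forall i j, is_derive t 1 (fun s => f s i j) (df i j).
Proof.
split=> [[fd <-] i j | fd].
  apply: DeriveDef; first by move/derivable_mxP: fd; apply.
  by rewrite derive_mx// mxE.
have fd' : derivable f t 1.
  by apply/derivable_mxP => i j; have [] := fd i j.
apply: DeriveDef => //; rewrite derive_mx//; apply/matrixP => i j.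
by rewrite mxE; have [_ ->] := fd i j.
Qed.

Lemma is_derive_const t (c : R) : is_derive t 1 (fun=> c) (0 : R).
Proof. exact: is_derive_cst. Qed.

Lemma is_derive_add (V : normedModType R) t (f g : R -> V) (df dg : V) :
  is_derive t 1 f df -> is_derive t 1 g dg ->
  is_derive t 1 (fun s => f s + g s) (df + dg).
Proof. by move=> ? ?; exact: is_deriveD. Qed.

Lemma is_derive_sub (V : normedModType R) t (f g : R -> V) (df dg : V) :
  is_derive t 1 f df -> is_derive t 1 g dg ->
  is_derive t 1 (fun s => f s - g s) (df - dg).
Proof. by move=> ? ?; exact: is_deriveB. Qed.

Lemma is_derive_mul t (f g : R -> R) (df dg : R) :
  is_derive t 1 f df -> is_derive t 1 g dg ->
  is_derive t 1 (fun s => f s * g s) (df * g t + f t * dg).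
Proof.
move=> fd gd; apply: (is_derive_eq (is_deriveM fd gd)).
by rewrite addrC; congr (_ + _); apply: mulrC.
Qed.

Lemma is_derive_inv t (f : R -> R) (df : R) :
  is_derive t 1 f df -> f t != 0 ->
  is_derive t 1 (fun s => (f s)^-1) (- df / f t ^+ 2).
Proof.
move=> [fd <-] f0; apply: DeriveDef; first exact: derivableV.
by rewrite deriveV// mulNr mulrC -mulNr.
Qed.

Lemma is_derive_sum_fun n t (f : 'I_n -> R -> R) (df : 'I_n -> R) :
  (forall i, is_derive t 1 (f i) (df i)) ->
  is_derive t 1 (fun s => \sum_(i < n) f i s) (\sum_(i < n) df i).
Proof.
move=> fd; have := @is_derive_sum _ _ _ n f t 1 df fd.
by congr is_derive; apply/funext => s; rewrite fct_sumE.
Qed.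

Lemma is_derive_scale n t (k : R -> R) (f : R -> 'cV[R]_n) dk df :
  is_derive t 1 k dk -> is_derive t 1 f df ->
  is_derive t 1 (fun s => k s *: f s) (dk *: f t + k t *: df).
Proof.
move=> kd /is_derive_mxP fd; apply/is_derive_mxP => i j; rewrite !mxE.
under eq_fun do rewrite mxE.
exact: is_derive_mul.
Qed.

Lemma is_derive_dot n t (f g : R -> 'cV[R]_n) df dg :
  is_derive t 1 f df -> is_derive t 1 g dg ->
  is_derive t 1 (fun s => dot (f s) (g s)) (dot df (g t) + dot (f t) dg).
Proof.
move=> /is_derive_mxP fd /is_derive_mxP gd.
rewrite /dot -big_split; apply: is_derive_sum_fun => i.
exact: is_derive_mul.
Qed.

Lemma is_derive_mulmx m n t (M : R -> 'M[R]_(m, n)) (f : R -> 'cV[R]_n) dM df :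
  is_derive t 1 M dM -> is_derive t 1 f df ->
  is_derive t 1 (fun s => M s *m f s) (dM *m f t + M t *m df).
Proof.
move=> /is_derive_mxP Md /is_derive_mxP fd; apply/is_derive_mxP => i j.
rewrite !mxE -big_split; under eq_fun do rewrite mxE.
apply: is_derive_sum_fun => k; exact: is_derive_mul.
Qed.

Lemma is_derive_pair5 t (v : R -> 'cV[R]_4) (a : R -> R) dv da :
  is_derive t 1 v dv -> is_derive t 1 a da ->
  is_derive t 1 (fun s => pair5 (v s) (a s)) (pair5 dv da).
Proof.
move=> /is_derive_mxP vd ad; apply/is_derive_mxP => i j.
rewrite /pair5 !mxE; under eq_fun do rewrite !mxE.
case: (splitP (i : 'I_(4 + 1))) => k _; first exact: vd.
by rewrite !mxE; under eq_fun do rewrite !mxE; rewrite !ord1.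
Qed.

Lemma is_derive_near n t I (f g : R -> 'cV[R]_n) df : open I -> I t ->
  (forall s, I s -> f s = g s) -> is_derive t 1 g df -> is_derive t 1 f df.
Proof.
move=> oI It fg; apply: near_eq_is_derive.
near=> s; apply/esym/fg; near: s; exact: open_nbhs_nbhs.
Unshelve. all: end_near. Qed.

Lemma derive1_val (V : normedModType R) t (f : R -> V) df :
  is_derive t 1 f df -> derive1 f t = df.
Proof. by case=> _ <-; rewrite derive1E. Qed.

Lemma derivable_is_derive1 (V : normedModType R) t (f : R -> V) :
  derivable f t 1 -> is_derive t 1 f (derive1 f t).
Proof. by move=> fd; rewrite derive1E; exact: derivableP. Qed.

(** The mean value theorem, for curves that solve their equation only on an
    interval and are arbitrary outside it. *)
Lemma constant_on_interval I (f : R -> R) : is_interval I ->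
  (forall t, I t -> is_derive t 1 f 0) ->
  forall s t, I s -> I t -> f s = f t.
Proof.
move=> itvI fd s t; wlog lest : s t / s <= t.
  by move=> th Is It; have [?|/ltW?] := leP s t; [|apply/esym]; apply: th.
move=> Is It.
have sub c : c \in `[s, t]%R -> I c.
  by rewrite in_itv => /= cst; apply: itvI cst.
have fd' c : c \in `]s, t[%R -> is_derive c 1 f 0.
  by move=> cst; apply/fd/sub/subset_itv_oo_cc.
have fc : {within `[s, t], continuous f}.
  by apply: derivable_within_continuous => c /sub /fd [].
have [c _] := @MVT_segment _ f (fun=> 0) s t lest fd' fc.
by rewrite mul0r => /eqP; rewrite subr_eq0 => /eqP.
Qed.
End Calculus.

(** * Euclidean inner product and the matrices E, A, B *)

Section Algebra.
Context {R : realType}.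

Lemma dotC n (v w : 'cV[R]_n) : dot v w = dot w v.
Proof. by apply: eq_bigr => i _; rewrite mulrC. Qed.

Lemma dotDr n (a v w : 'cV[R]_n) : dot a (v + w) = dot a v + dot a w.
Proof. by rewrite -big_split; apply: eq_bigr => i _; rewrite mxE mulrDr. Qed.

Lemma dotZr n k (a v : 'cV[R]_n) : dot a (k *: v) = k * dot a v.
Proof.
by rewrite /dot mulr_sumr; apply: eq_bigr => i _; rewrite mxE mulrCA.
Qed.

Lemma dotNr n (a v : 'cV[R]_n) : dot a (- v) = - dot a v.
Proof. by rewrite -scaleN1r dotZr mulN1r. Qed.

Lemma dotDl n (a v w : 'cV[R]_n) : dot (v + w) a = dot v a + dot w a.
Proof. by rewrite !(dotC _ a) dotDr. Qed.

Lemma dotZl n k (a v : 'cV[R]_n) : dot (k *: v) a = k * dot v a.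
Proof. by rewrite !(dotC _ a) dotZr. Qed.

Lemma dotNl n (a v : 'cV[R]_n) : dot (- v) a = - dot v a.
Proof. by rewrite !(dotC _ a) dotNr. Qed.

Lemma dot0r n (a : 'cV[R]_n) : dot a 0 = 0.
Proof. by rewrite -(scale0r 0) dotZr mul0r. Qed.

Definition dotE := (dotDr, dotZr, dotNr, dotDl, dotZl, dotNl).

Lemma dot_ge0 n (v : 'cV[R]_n) : 0 <= dot v v.
Proof. by apply: sumr_ge0 => i _; rewrite -expr2 sqr_ge0. Qed.

Lemma dot_eq0 n (v : 'cV[R]_n) : (dot v v == 0) = (v == 0).
Proof.
apply/eqP/eqP => [v0 | ->]; last exact: dot0r.
have /psumr_eq0P vi0 : forall i, xpredT i -> 0 <= v i 0 * v i 0.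
  by move=> i _; rewrite -expr2 sqr_ge0.
apply/matrixP => i j; rewrite ord1 mxE; apply/eqP.
by have /eqP := vi0 v0 i isT; rewrite mulf_eq0 orbb.
Qed.

Lemma dot_gt0 n (v : 'cV[R]_n) : (0 < dot v v) = (v != 0).
Proof. by rewrite lt_def dot_ge0 andbT dot_eq0. Qed.

Lemma sqr_enorm n (v : 'cV[R]_n) : enorm v ^+ 2 = dot v v.
Proof. by rewrite sqr_sqrtr// dot_ge0. Qed.

Lemma dot1_neq0 n (v : 'cV[R]_n) : dot v v + 1 != 0.
Proof. by rewrite gt_eqF// ltr_wpDl// dot_ge0. Qed.

Lemma pair5D (v w : 'cV[R]_4) a b :
  pair5 v a + pair5 w b = pair5 (v + w) (a + b).
Proof. by rewrite /pair5 raddfD; exact: (@add_col_mx _ 4 1 1). Qed.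

Lemma pair5Z k (v : 'cV[R]_4) a : k *: pair5 v a = pair5 (k *: v) (k * a).
Proof. by rewrite /pair5 -scale_scalar_mx; exact: (@scale_col_mx _ 4 1 1). Qed.

Lemma dot_pair5 (v w : 'cV[R]_4) a b :
  dot (pair5 v a) (pair5 w b) = dot v w + a * b.
Proof.
have u (i : 'I_4) x (y : 'cV[R]_4) : pair5 y x (lshift 1 i) 0 = y i 0.
  exact: col_mxEu.
have d x (y : 'cV[R]_4) : pair5 y x (rshift 4 (0 : 'I_1)) 0 = x.
  by apply: etrans (col_mxEd _ _ _ _) _; rewrite mxE.
rewrite /dot [LHS](@big_split_ord _ _ _ 4 1) /= big_ord1 !d.
by congr (_ + _); apply: eq_bigr => i _; rewrite !u.
Qed.

Lemma ord4P (P : 'I_4 -> Prop) :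
  P 0 -> P 1 -> P 2%:R -> P 3%:R -> forall i, P i.
Proof.
move=> P0 P1 P2 P3 [[|[|[|[|//]]]] i4].
- by rewrite (_ : Ordinal i4 = 0)//; exact/val_inj.
- by rewrite (_ : Ordinal i4 = 1)//; exact/val_inj.
- by rewrite (_ : Ordinal i4 = 2%:R)//; exact/val_inj.
- by rewrite (_ : Ordinal i4 = 3%:R)//; exact/val_inj.
Qed.

Lemma sum4 (F : 'I_4 -> R) : \sum_(i < 4) F i = F 0 + F 1 + F 2%:R + F 3%:R.
Proof.
rewrite !big_ord_recl big_ord0 addr0 !addrA.
by do ![congr (_ + _)]; congr F; exact/val_inj.
Qed.

Lemma sum3 (F : 'I_3 -> R) : \sum_(i < 3) F i = F 0 + F 1 + F 2%:R.
Proof.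
rewrite !big_ord_recl big_ord0 addr0 !addrA.
by do ![congr (_ + _)]; congr F; exact/val_inj.
Qed.

(** The multirules Emx_coords, crossmx_coords and Amx_coords evaluate the
    entries of products by small matrices once and for all, so that the
    polynomial identities below are decided on the entries of the vectors. *)
Lemma Emx_coords (e : 'cV[R]_3) (w : 'cV[R]_4) :
  (((Emx e *m w) 0 0 = e 0 0 * w 1 0 + e 1 0 * w 2%:R 0 + e 2%:R 0 * w 3%:R 0)%R
 * ((Emx e *m w) 1 0
    = - e 0 0 * w 0 0 - e 2%:R 0 * w 2%:R 0 + e 1 0 * w 3%:R 0)%R
 * ((Emx e *m w) 2%:R 0
    = - e 1 0 * w 0 0 + e 2%:R 0 * w 1 0 - e 0 0 * w 3%:R 0)%R
 * ((Emx e *m w) 3%:R 0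
    = - e 2%:R 0 * w 0 0 - e 1 0 * w 1 0 + e 0 0 * w 2%:R 0)%R)%type.
Proof.
by do !split; rewrite mxE sum4 /Emx !mxE /= ?mul0r ?addr0 ?add0r ?mulNr.
Qed.

(** The matrix of the cross product by b; Bmx u du is by definition
    crossmx (Amx u *m du). *)
Definition crossmx (b : 'cV[R]_3) : 'M[R]_3 :=
  mx_of_rows 3 3
    [:: [::         0; - b 2%:R 0;     b 1 0];
        [::   b 2%:R 0;         0;   - b 0 0];
        [::   - b 1 0;     b 0 0;          0]].

Lemma crossmx_coords (b e : 'cV[R]_3) :
  (((crossmx b *m e) 0 0 = b 1 0 * e 2%:R 0 - b 2%:R 0 * e 1 0)%R
 * ((crossmx b *m e) 1 0 = b 2%:R 0 * e 0 0 - b 0 0 * e 2%:R 0)%R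
 * ((crossmx b *m e) 2%:R 0 = b 0 0 * e 1 0 - b 1 0 * e 0 0)%R)%type.
Proof. by do !split; rewrite mxE sum3 !mxE /=; ring. Qed.

Lemma Amx_coords (u v : 'cV[R]_4) (d := (dot u u + 1)^-1) :
  (((Amx u *m v) 0 0
    = d * (- u 1 0 * v 0 0 + u 0 0 * v 1 0 + u 3%:R 0 * v 2%:R 0
           - u 2%:R 0 * v 3%:R 0))%R
 * ((Amx u *m v) 1 0
    = d * (- u 2%:R 0 * v 0 0 - u 3%:R 0 * v 1 0 + u 0 0 * v 2%:R 0
           + u 1 0 * v 3%:R 0))%R
 * ((Amx u *m v) 2%:R 0
    = d * (- u 3%:R 0 * v 0 0 + u 2%:R 0 * v 1 0 - u 1 0 * v 2%:R 0
           + u 0 0 * v 3%:R 0))%R)%type.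
Proof.
by do !split; rewrite /Amx sqr_enorm -/d -scalemxAl mxE mxE sum4 !mxE /= ?mulNr.
Qed.

(** The specific rules must precede mxE, which would otherwise expand the
    products into sums. *)
Definition coordsE :=
  (@Emx_coords, @crossmx_coords, @Amx_coords, (fun n => @mxE R n 1)).

Lemma Emx_scale k (e : 'cV[R]_3) (w : 'cV[R]_4) :
  Emx (k *: e) *m w = k *: (Emx e *m w).
Proof.
by apply/matrixP => i j; rewrite ord1; elim/ord4P: i; rewrite !coordsE; ring.
Qed.

Lemma dot_Emx_id (e : 'cV[R]_3) (v : 'cV[R]_4) : dot v (Emx e *m v) = 0.
Proof. by rewrite /dot sum4 !coordsE; ring. Qed.

Lemma dot_Emx (e : 'cV[R]_3) (v w : 'cV[R]_4) :
  dot v (Emx e *m w) = - dot (Emx e *m v) w.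
Proof. by rewrite /dot !sum4 !coordsE; ring. Qed.

(** Up to the factor - 1 / N, the rows of Amx u are the images of u under the
    three imaginary quaternion units, which Emx combines with weights e. *)
Lemma dot_Amx (u v : 'cV[R]_4) (e : 'cV[R]_3) :
  dot (Amx u *m v) e = dot u (Emx e *m v) / (dot u u + 1).
Proof.
rewrite [dot u (Emx _ *m _)]/dot sum4 !coordsE {1}/dot sum3 !Amx_coords.
by move: (dot u u + 1)^-1 => d; ring.
Qed.

Lemma dot_crossmx (b e : 'cV[R]_3) : dot e (crossmx b *m e) = 0.
Proof. by rewrite /dot sum3 !coordsE; ring. Qed.

Lemma crossmx_id (e : 'cV[R]_3) : crossmx e *m e = 0.
Proof.
apply/matrixP => -[[|[|[|//]]] i3] j; rewrite ord1 mxE sum3 !mxE /=; ring.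
Qed.

(** The quaternion rule: e |-> Emx e is the action of imaginary quaternions
    on R^4, whose product is made of a cross product and a scalar product. *)
Lemma Emx_mul (b e : 'cV[R]_3) (w : 'cV[R]_4) :
  Emx e *m (Emx b *m w) = - (Emx (crossmx b *m e) *m w) - dot b e *: w.
Proof.
apply/matrixP => i j; rewrite ord1 /dot sum3.
by elim/ord4P: i; rewrite !coordsE; ring.
Qed.

Lemma Emx_sqr (e : 'cV[R]_3) (w : 'cV[R]_4) :
  Emx e *m (Emx e *m w) = - dot e e *: w.
Proof.
by rewrite Emx_mul crossmx_id -[X in Emx X](scale0r e) Emx_scale scale0r oppr0
  sub0r scaleNr.
Qed.

(** For v <> 0 the images of v under 1 and the three quaternion units form
    an orthogonal basis of R^4; N Amx u *m v collects the scalar products of u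
    with the last three, so that this is the expansion of |v|^2 u in this
    basis. *)
Lemma Emx_Amx (u v : 'cV[R]_4) :
  Emx (Amx u *m v) *m v =
  (dot u u + 1)^-1 *: (dot v v *: u - dot u v *: v).
Proof.
apply/matrixP => i j; rewrite ord1 [dot v v]/dot [dot u v]/dot !sum4.
elim/ord4P: i; rewrite !coordsE;
  by move: (dot u u + 1)^-1 => d; ring.
Qed.

(** The rate of change of E imposed by the equation for e. The right-hand
    side is a combination of Christoffel terms: with factor - 2 it equals
    E (Gamma (v, v)) - Gamma (v, E v), that is, E is parallel along u. The
    identity follows from the quaternion rule with b = Amx u *m v, the product
    by b being eliminated with Emx_Amx. *)
Lemma Emx_Bmx (u v : 'cV[R]_4) (e : 'cV[R]_3) :
  Emx (Bmx u v *m e) *m v =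
  - (dot u u + 1)^-1 *: (dot v v *: (Emx e *m u) - dot u v *: (Emx e *m v)
       + dot u (Emx e *m v) *: v).
Proof.
have := Emx_mul (Amx u *m v) e v.
rewrite Emx_Amx dot_Amx -scalemxAr mulmxBr -!scalemxAr -/(crossmx _) => h.
apply: oppr_inj; rewrite -scaleNr opprK scalerDr {}h scalerA.
by rewrite [_ / _]mulrC subrK.
Qed.
End Algebra.

(** * Geometry of the inverse stereographic projection *)

Section Stereographic.
Context {R : realType}.
Implicit Types (t : R) (u v w : 'cV[R]_4).

(** The differential at u, in the direction w, of v |-> stereo v 1; see
    is_derive_stereo. *)
Definition dstereo u w : 'cV[R]_5 :=
  pair5 ((2 / (dot u u + 1)) *: w - (4 * dot u w / (dot u u + 1) ^+ 2) *: u)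
        (4 * dot u w / (dot u u + 1) ^+ 2).

(** The Christoffel symbols of the round metric 4 |du|^2 / (|u|^2 + 1)^2. *)
Definition christoffel u v w : 'cV[R]_4 :=
  (2 / (dot u u + 1)) *: (dot v w *: u - dot u v *: w - dot u w *: v).

Lemma stereo_scale u (r : R) : stereo u r = r *: stereo u 1.
Proof.
rewrite /stereo sqr_enorm pair5Z scalerA; congr (pair5 (_ *: _) _); ring.
Qed.

Lemma dot_stereo u : dot (stereo u 1) (stereo u 1) = 1.
Proof.
have N0 := dot1_neq0 u.
by rewrite /stereo sqr_enorm dot_pair5 !dotE; field.
Qed.

Lemma dot_stereo_dstereo u w : dot (stereo u 1) (dstereo u w) = 0.
Proof.
have N0 := dot1_neq0 u.
by rewrite /stereo sqr_enorm dot_pair5 !dotE; field.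
Qed.

Lemma dot_dstereo u v w :
  dot (dstereo u v) (dstereo u w) = 4 * dot v w / (dot u u + 1) ^+ 2.
Proof.
have N0 := dot1_neq0 u.
by rewrite /dstereo dot_pair5 !dotE (dotC v u); field.
Qed.

Lemma dstereo_linear u k v w :
  dstereo u (k *: v + w) = k *: dstereo u v + dstereo u w.
Proof.
have N0 := dot1_neq0 u.
rewrite /dstereo pair5Z pair5D; congr pair5.
  by apply/matrixP => i j; rewrite !mxE !dotE; field.
by rewrite !dotE; field.
Qed.

Lemma dstereo0 u : dstereo u 0 = 0.
Proof.
have := dstereo_linear u (-1) 0 0.
by rewrite scaler0 addr0 scaleN1r addNr.
Qed.

Lemma dstereoZ u k w : dstereo u (k *: w) = k *: dstereo u w.
Proof. by rewrite -[k *: w]addr0 dstereo_linear dstereo0 addr0. Qed.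

Lemma dstereoD u v w : dstereo u (v + w) = dstereo u v + dstereo u w.
Proof. by rewrite -[v]scale1r dstereo_linear !scale1r. Qed.

Section Derivatives.
Context (t : R) (u : R -> 'cV[R]_4) (du : 'cV[R]_4)
  (ud : is_derive t 1 u du).

Let is_derive_norm2 :
  is_derive t 1 (fun s => dot (u s) (u s) + 1) (2 * dot (u t) du).
Proof.
apply: is_derive_eq.
  by apply: is_derive_add; exact: is_derive_dot ud ud.
by rewrite (dotC du); ring.
Qed.

Lemma is_derive_stereo :
  is_derive t 1 (fun s => stereo (u s) 1) (dstereo (u t) du).
Proof.
have N0 := dot1_neq0 (u t).
have iN := is_derive_inv is_derive_norm2 N0.
rewrite /stereo; under eq_fun do rewrite sqr_enorm.
have k1 := is_derive_mul (is_derive_const t (2 * 1)) iN.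
have k2 := is_derive_mul
  (is_derive_sub (is_derive_dot ud ud) (is_derive_const t 1)) iN.
have k3 := is_derive_mul (is_derive_const t 1) k2.
apply: (is_derive_eq (is_derive_pair5 (is_derive_scale k1 ud) k3)).
rewrite /dstereo; congr pair5.
  by apply/matrixP => i j; rewrite !mxE; field.
by rewrite (dotC du); field.
Qed.

(** The Gauss formula of the unit sphere: the tangential part of the
    derivative of a tangent field is its covariant derivative, and its normal
    part is given by the second fundamental form - <., .> xi. *)
Lemma is_derive_dstereo (w : R -> 'cV[R]_4) (dw : 'cV[R]_4) :
  is_derive t 1 w dw ->
  is_derive t 1 (fun s => dstereo (u s) (w s))
    (dstereo (u t) (dw + christoffel (u t) du (w t))
     - (4 * dot du (w t) / (dot (u t) (u t) + 1) ^+ 2) *: stereo (u t) 1).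
Proof.
move=> wd.
have N0 := dot1_neq0 (u t).
have iN := is_derive_inv is_derive_norm2 N0.
have iN2 : is_derive t 1 (fun s => ((dot (u s) (u s) + 1) ^+ 2)^-1)
    (- 4 * dot (u t) du / (dot (u t) (u t) + 1) ^+ 3).
  under eq_fun do rewrite expr2 invfM.
  by apply: (is_derive_eq (is_derive_mul iN iN)); field.
have ad : is_derive t 1
    (fun s => 4 * dot (u s) (w s) / (dot (u s) (u s) + 1) ^+ 2)
    (4 * (dot du (w t) + dot (u t) dw) / (dot (u t) (u t) + 1) ^+ 2
     - 16 * dot (u t) (w t) * dot (u t) du / (dot (u t) (u t) + 1) ^+ 3).
  have k := is_derive_mul (is_derive_const t (4))
    (is_derive_dot ud wd).
  by apply: (is_derive_eq (is_derive_mul k iN2)); field.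
have k1 := is_derive_mul (is_derive_const t (2)) iN.
apply: (is_derive_eq (is_derive_pair5
  (is_derive_sub (is_derive_scale k1 wd)
    (is_derive_scale ad ud)) ad)).
rewrite /dstereo /stereo sqr_enorm pair5Z -[- pair5 _ _]scaleN1r pair5Z pair5D.
rewrite /christoffel !dotE; congr pair5.
  by apply/matrixP => i j; rewrite !mxE; field.
by field.
Qed.
End Derivatives.

(** The splitting of L into its radial part and its part tangent to the
    sphere, on which all properties of L are read off. *)
Lemma Lvec_dstereo u w (r : R) (e : 'cV[R]_3) :
  Lvec u w r e = (dot e e / 4) *: stereo u 1
                 + (r ^+ 2 / 2) *: dstereo u (Emx e *m w).
Proof.
have N0 := dot1_neq0 u.
rewrite /Lvec /stereo /dstereo !sqr_enorm dot_Amx !pair5Z pair5D; congr pair5.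
  by apply/matrixP => i j; rewrite ord1 !mxE; field.
by field.
Qed.

Lemma dot_stereo_Lvec u w (r : R) (e : 'cV[R]_3) :
  dot (stereo u 1) (Lvec u w r e) = dot e e / 4.
Proof.
by rewrite Lvec_dstereo !dotE dot_stereo dot_stereo_dstereo mulr0 addr0 mulr1.
Qed.

Lemma dot_Lvec u w (r : R) (e : 'cV[R]_3) :
  dot (Lvec u w r e) (Lvec u w r e) =
  dot e e / 4 * (dot e e / 4 + r ^+ 4 * dot (dstereo u w) (dstereo u w)).
Proof.
have EE : dot (Emx e *m w) (Emx e *m w) = dot e e * dot w w.
  by rewrite -[LHS]opprK -dot_Emx Emx_sqr dotE mulNr opprK.
have N0 := dot1_neq0 u.
rewrite Lvec_dstereo !dotE dot_stereo (dotC (dstereo _ _)) dot_stereo_dstereo.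
by rewrite !dot_dstereo EE; field.
Qed.
End Stereographic.

(** * Tangent vectors of a cone *)

Section Cone.
Context {R : realType}.

Lemma cone_eq n (L x : 'cV[R]_n) (psi : R) : L != 0 -> cone L psi x ->
  dot x L ^+ 2 = cos psi ^+ 2 * dot L L * dot x x.
Proof.
move=> L0 [x0 <-]; rewrite expr_div_n exprMn !sqr_enorm.
have xx : dot x x != 0 by rewrite dot_eq0.
have LL : dot L L != 0 by rewrite dot_eq0.
by field; rewrite ?xx ?LL.
Qed.

(** Differentiating the squared equation of the cone along a curve avoids the
    derivative of the norm. When x . L <> 0 this says that v is orthogonal to
    the normal of the cone at x. *)
Lemma cone_tangent n (L x v : 'cV[R]_n.+1) (psi : R) : L != 0 ->
  tangent_vector (cone L psi) x v ->
  dot x L * dot v L = cos psi ^+ 2 * dot L L * dot x v.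
Proof.
move=> L0 [g [<- gC gd g'0]].
have {}gd : is_derive (0 : R) 1 g v.
  by rewrite -g'0; exact: derivable_is_derive1.
set k := cos psi ^+ 2 * dot L L.
have Ld : is_derive (0 : R) 1 (fun s => dot (g s) L) (dot v L).
  apply: (is_derive_eq (is_derive_dot gd (is_derive_cst L _ _))).
  by rewrite dot0r addr0.
have d1 := is_derive_mul Ld Ld.
have d2 := is_derive_mul (is_derive_const 0 k) (is_derive_dot gd gd).
have d3 := is_derive_sub d1 d2.
have d4 : is_derive (0 : R) 1
    (fun s => dot (g s) L * dot (g s) L - k * dot (g s) (g s)) 0.
  apply: (@near_eq_is_derive _ _ _ (fun=> 0)).
  near=> s; apply/esym/eqP; rewrite subr_eq0 -expr2; apply/eqP/cone_eq => //.
  by near: s; exact: gC.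
have /eqP := etrans (esym (derive1_val d3)) (derive1_val d4).
by rewrite (dotC v (g 0)) subr_eq0 => /eqP h; lra.
Unshelve. all: end_near. Qed.
End Cone.

(** * Acceleration and conserved quantities *)

Lemma is_derive_Emx (R : realType) (t : R) (e : R -> 'cV[R]_3) (de : 'cV[R]_3) :
  is_derive t 1 e de -> is_derive t 1 (fun s => Emx (e s)) (Emx de).
Proof.
move=> /is_derive_mxP ed; apply/is_derive_mxP; elim/ord4P; elim/ord4P;
  rewrite /Emx mxE /=; under eq_fun do rewrite mxE /=;
  first [exact: is_derive_const | exact: ed | exact: is_deriveN (ed _ _)].
Qed.

Section Dynamics.
Context {R : realType} (I : set R) (x : R -> 'cV[R]_5) (e : R -> 'cV[R]_3)
  (u : R -> 'cV[R]_4) (r : R -> R) (openI : open I)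
  (sol : poincare_solution I x e u r).
Let v := derive1 u.

(** The squared speed of the projection of x to the unit sphere. *)
Let speed2 t := dot (dstereo (u t) (v t)) (dstereo (u t) (v t)).

Lemma r_gt0 t : I t -> 0 < r t.
Proof. by case: sol => + _ => /[apply] -[]. Qed.

Lemma x_stereo t : I t -> x t = r t *: stereo (u t) 1.
Proof. by case: sol => + _ => /[apply] -[_ ->]; rewrite -stereo_scale. Qed.

Lemma is_derive_u t : I t -> is_derive t 1 u (v t).
Proof.
by case: sol => _ /[apply] -[[ud _ _ _ _] _ _ _]; exact: derivable_is_derive1.
Qed.

Lemma is_derive_r t : I t -> is_derive t 1 r (derive1 r t).
Proof.
by case: sol => _ /[apply] -[[_ _ rd _ _] _ _ _]; exact: derivable_is_derive1.
Qed.

Lemma is_derive_e t : I t ->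
  is_derive t 1 e (- 2 *: (Bmx (u t) (v t) *m e t)).
Proof.
case: sol => _ /[apply] -[[_ _ _ _ ed] _ _ /addr0_eq e'].
rewrite scaleNr -/v in e' *; rewrite -e' opprK; exact: derivable_is_derive1.
Qed.

Lemma is_derive_dr t : I t ->
  is_derive t 1 (derive1 r) (r t * speed2 t).
Proof.
case: sol => _ /[apply] -[[_ _ _ rd _] _ + _].
rewrite !sqr_enorm => /subr0_eq r''.
apply: (is_derive_eq (derivable_is_derive1 rd)).
by rewrite -[LHS]/(derive1n 2 r t) r'' /speed2 dot_dstereo; ring.
Qed.

(** The value of u'' given by its equation; adding the Christoffel term leaves
    the covariant acceleration of u. *)
Let accel t : 'cV[R]_4 :=
  - (2 * derive1 r t / r t) *: v t + (2 * r t ^+ 2)^-1 *: (Emx (e t) *m v t)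
  - christoffel (u t) (v t) (v t).

Lemma is_derive_du t : I t -> is_derive t 1 v (accel t).
Proof.
move=> It; case: sol => _ /(_ t It) [[_ ud _ _ _] u'' _ _].
apply: (is_derive_eq (derivable_is_derive1 ud)).
rewrite -/v /accel -{}u'' !sqr_enorm -[derive1 (derive1 u) t]/(derive1n 2 u t).
by apply/matrixP => i j; rewrite !mxE; ring.
Qed.

Lemma is_derive_x t : I t ->
  is_derive t 1 x (derive1 r t *: stereo (u t) 1 + r t *: dstereo (u t) (v t)).
Proof.
move=> It.
apply: (@is_derive_near _ _ _ I _ (fun s => r s *: stereo (u s) 1)) => //.
  exact: x_stereo.
exact: is_derive_scale (is_derive_r It) (is_derive_stereo (is_derive_u It)).
Qed.

(** The radial equation cancels the component of x'' along x, and the term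
    2 r' u' / r of the equation for u cancels the Coriolis term 2 r' xi'. *)
Lemma is_derive_dx t : I t ->
  is_derive t 1 (derive1 x)
    ((2 * r t)^-1 *: dstereo (u t) (Emx (e t) *m v t)).
Proof.
move=> It; apply: (@is_derive_near _ _ _ I _ (fun s =>
    derive1 r s *: stereo (u s) 1 + r s *: dstereo (u s) (v s))) => //.
  by move=> s Is; apply: derive1_val; exact: is_derive_x.
have ud := is_derive_u It.
have d1 := is_derive_scale (is_derive_dr It) (is_derive_stereo ud).
have d2 := is_derive_scale (is_derive_r It)
  (is_derive_dstereo ud (is_derive_du It)).
apply: (is_derive_eq (is_derive_add d1 d2)).
have r0 : r t != 0 by rewrite gt_eqF// r_gt0.
rewrite /accel subrK !(dstereoD, dstereoZ) -dot_dstereo /speed2.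
move: (stereo _ _) (dstereo _ (v t)) (dstereo _ (_ *m _)) => p q w.
by apply/matrixP => i j; rewrite !mxE; field.
Qed.

Lemma is_derive_norm2_e t : I t -> is_derive t 1 (fun s => dot (e s) (e s)) 0.
Proof.
move=> /is_derive_e ed; apply: (is_derive_eq (is_derive_dot ed ed)).
by rewrite (dotC _ (e t)) dotE -/(crossmx _) dot_crossmx mulr0 addr0.
Qed.

(** Conservation of |x|^4 |xi'|^2: the force E u' is orthogonal to u'. *)
Lemma is_derive_angular_momentum t : I t ->
  is_derive t 1 (fun s => r s ^+ 4 * speed2 s) 0.
Proof.
move=> It; have rd := is_derive_r It; have ud := is_derive_u It.
have dd := is_derive_dstereo ud (is_derive_du It).
have r2 := is_derive_mul rd rd.
have r4 := is_derive_mul r2 r2.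
have sd := is_derive_dot dd dd.
have -> : (fun s => r s ^+ 4 * speed2 s) =
    (fun s => (r s * r s) * (r s * r s) * speed2 s).
  by apply/funext => s; ring.
apply: (is_derive_eq (is_derive_mul r4 sd)).
have r0 : r t != 0 by rewrite gt_eqF// r_gt0.
rewrite /accel subrK !dotE.
rewrite !(dotC _ (dstereo (u t) (v t))) (dotC (dstereo _ _) (stereo _ _)).
rewrite dot_stereo_dstereo dstereoD !dstereoZ !dotE.
rewrite [dot _ (dstereo _ (Emx _ *m _))]dot_dstereo dot_Emx_id /speed2.
have N0 := dot1_neq0 (u t).
by field; rewrite N0 r0.
Qed.

Lemma is_derive_Emx_v t : I t ->
  is_derive t 1 (fun s => Emx (e s) *m v s)
    (Emx (- 2 *: (Bmx (u t) (v t) *m e t)) *m v t + Emx (e t) *m accel t).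
Proof.
move=> It; apply: is_derive_mulmx (is_derive_du It).
exact: is_derive_Emx (is_derive_e It).
Qed.

(** By the Gauss formula the derivative of L is the image under dstereo of a
    vector of R^4, as E u' is orthogonal to u'. This vector vanishes since E is
    parallel (Emx_Bmx) and E^2 = - |e|^2. *)
Lemma is_derive_Lvec t : I t ->
  is_derive t 1 (fun s => Lvec (u s) (v s) (r s) (e s)) 0.
Proof.
move=> It; have rd := is_derive_r It; have ud := is_derive_u It.
under eq_fun do rewrite Lvec_dstereo.
have c := is_derive_mul (is_derive_norm2_e It) (is_derive_const t 4^-1).
have k := is_derive_mul (is_derive_mul rd rd)
  (is_derive_const t 2^-1).
have dE := is_derive_dstereo ud (is_derive_Emx_v It).
apply: (is_derive_eq (is_derive_add
  (is_derive_scale c (is_derive_stereo ud)) (is_derive_scale k dE))).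
rewrite dot_Emx_id !(mulr0, mul0r, addr0, scale0r, subr0, add0r).
rewrite -!dstereoZ -!dstereoD -[RHS](dstereo0 (u t)); congr dstereo.
have r0 : r t != 0 by rewrite gt_eqF// r_gt0.
have N0 := dot1_neq0 (u t).
rewrite Emx_scale Emx_Bmx /accel /christoffel.
rewrite !(mulmxDr, mulmxN) -!scalemxAr !mulmxBr -!scalemxAr Emx_sqr dot_Emx_id.
move: (Emx (e t) *m u t) (Emx (e t) *m v t) => Eu Ev.
by apply/matrixP => i j; rewrite !mxE; field; rewrite r0 N0.
Qed.
End Dynamics.

(** * Position and acceleration with respect to the cone *)

Section Aperture.
Context {R : realType} (u w : 'cV[R]_4) (r : R) (e : 'cV[R]_3).
Let lambda2 := r ^+ 4 * dot (dstereo u w) (dstereo u w).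

Let quarter_norm2 : dot e e / 4 = (enorm e / 2) ^+ 2.
Proof. by rewrite expr_div_n sqr_enorm; field. Qed.

(** The aperture is the angle between the hypotenuse and the leg of length
    |e| / 2 in a right triangle whose other leg is the angular momentum. *)
Lemma cos_apertureE :
  cos_aperture u w r e = enorm e / 2 / Num.sqrt ((enorm e / 2) ^+ 2 + lambda2).
Proof.
rewrite /cos_aperture /lambda2 dot_dstereo; congr (_ / Num.sqrt _).
by rewrite !sqr_enorm expr_div_n sqr_enorm; field; rewrite dot1_neq0.
Qed.

Lemma enorm_Lvec :
  enorm (Lvec u w r e) =
  enorm e / 2 * Num.sqrt ((enorm e / 2) ^+ 2 + lambda2).
Proof.
rewrite [LHS]/enorm dot_Lvec quarter_norm2 sqrtrM ?sqr_ge0// sqrtr_sqr.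
rewrite ger0_norm//.
by rewrite divr_ge0// sqrtr_ge0.
Qed.

Context (r0 : 0 < r) (w0 : w != 0).

Lemma angular_momentum_gt0 : 0 < lambda2.
Proof.
have N0 : 0 < dot u u + 1 by rewrite ltr_wpDl ?dot_ge0.
rewrite /lambda2 dot_dstereo mulr_gt0 ?exprn_gt0// divr_gt0 ?exprn_gt0//.
by rewrite mulr_gt0// dot_gt0.
Qed.

Let hypotenuse_gt0 : 0 < Num.sqrt ((enorm e / 2) ^+ 2 + lambda2).
Proof. by rewrite sqrtr_gt0 ltr_wpDl ?sqr_ge0// angular_momentum_gt0. Qed.

Lemma cos_aperture_ge0_lt1 : 0 <= cos_aperture u w r e < 1.
Proof.
have e0 : 0 <= enorm e / 2 by rewrite divr_ge0// sqrtr_ge0.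
rewrite cos_apertureE; apply/andP; split; first exact: divr_ge0 (ltW _).
rewrite ltr_pdivrMr// mul1r.
rewrite -[X in X < _]ger0_norm// -sqrtr_sqr ltr_sqrt.
  by rewrite ltrDl angular_momentum_gt0.
by rewrite ltr_wpDl ?sqr_ge0// angular_momentum_gt0.
Qed.

Lemma cone_stereo (psi : R) : cos psi = cos_aperture u w r e ->
  cone (Lvec u w r e) psi (r *: stereo u 1).
Proof.
move=> psiE; split.
  by rewrite -dot_eq0 !dotE dot_stereo mulr1 mulf_neq0 ?gt_eqF.
have -> : enorm (r *: stereo u 1) = r.
  by rewrite /enorm !dotE dot_stereo mulr1 -expr2 sqrtr_sqr gtr0_norm.
rewrite psiE cos_apertureE enorm_Lvec dotE dot_stereo_Lvec quarter_norm2.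
move: hypotenuse_gt0; set q := Num.sqrt _ => q0.
have [->|s0] := eqVneq (enorm e / 2) 0; first by rewrite expr0n mulr0 !mul0r.
by move: s0; set s := enorm e / 2 => s0; field; rewrite s0 !gt_eqF.
Qed.

(** The acceleration is normal to the cone. With c = |e|^2 / 4, both x . L and
    |x| |L| cos psi equal c r, so that cone_tangent gives v . L = c xi . v when
    c <> 0, and the tangential part of L is left. If e = 0 that part, and with
    it the acceleration, vanishes. *)
Lemma dot_dstereo_tangent (psi : R) (v : 'cV[R]_5) :
  cos psi = cos_aperture u w r e ->
  tangent_vector (cone (Lvec u w r e) psi) (r *: stereo u 1) v ->
  dot (dstereo u (Emx e *m w)) v = 0.
Proof.
move=> psiE vt.
have [e0|e0] := eqVneq e 0.
  by rewrite e0 -[X in Emx X](scale0r 0) Emx_scale scale0r dstereo0 dotC dot0r.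
have c0 : 0 < dot e e / 4 by rewrite divr_gt0// dot_gt0.
have L0 : Lvec u w r e != 0.
  rewrite -dot_eq0 dot_Lvec -/lambda2 gt_eqF// mulr_gt0// addr_gt0//.
  exact: angular_momentum_gt0.
have := cone_tangent L0 vt.
have kL : cos psi ^+ 2 * dot (Lvec u w r e) (Lvec u w r e) = (dot e e / 4) ^+ 2.
  rewrite -sqr_enorm enorm_Lvec psiE cos_apertureE quarter_norm2.
  move: hypotenuse_gt0; set q := Num.sqrt _ => q0.
  by set s := enorm e / 2; field; rewrite gt_eqF.
rewrite kL !dotE dot_stereo_Lvec.
have -> : dot v (Lvec u w r e) = dot e e / 4 * dot (stereo u 1) v
    + r ^+ 2 / 2 * dot (dstereo u (Emx e *m w)) v.
  by rewrite Lvec_dstereo !dotE !(dotC v).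
move: (dot e e / 4) c0 (dot (stereo u 1) v) (dot (dstereo _ _) v).
move=> c c0 p q h.
(* The term c^2 r (xi . v) is common to both sides of cone_tangent. *)
have /eqP : (r ^+ 3 * c / 2) * q = 0 by nra.
by rewrite mulf_eq0 gt_eqF ?divr_gt0 ?mulr_gt0 ?exprn_gt0//= => /eqP.
Qed.
End Aperture.

Lemma acos_itv_pihalf (R : realType) (k : R) : 0 <= k < 1 ->
  0 < acos k <= pi / 2.
Proof.
move=> /andP[k0 k1]; have k1N : -1 <= k by rewrite (le_trans _ k0)// lerN10.
have k11 : -1 <= k <= 1 by rewrite k1N ltW.
rewrite acos_gt0 ?k1N//= leNgt -ltr_cos ?in_itv/= ?acos_ge0 ?acos_lepi//.
  by rewrite cos_pihalf acosK ?in_itv//= -leNgt.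
by rewrite divr_ge0 ?pi_ge0//= ler_pdivrMr// ler_peMr ?pi_ge0// ler1n.
Qed.

(** If u' vanished identically, x' would be (r' / r) x. *)
Lemma noncolliding_velocity (R : realType) (I : set R) (x : R -> 'cV[R]_5)
    (e : R -> 'cV[R]_3) (u : R -> 'cV[R]_4) (r : R -> R) :
  open I -> poincare_solution I x e u r -> ~ colliding I x ->
  exists2 t, I t & derive1 u t != 0.
Proof.
move=> openI sol; apply: contra_notP => h t It.
exists (derive1 r t / r t).
rewrite (derive1_val (is_derive_x openI sol It)).
have -> : derive1 u t = 0 by apply/eqP/negPn/negP => ut; apply: h; exists t.
rewrite dstereo0 scaler0 addr0 (x_stereo sol It) scalerA divfK//.
by rewrite gt_eqF// (r_gt0 sol).
Qed.

Unset Implicit Arguments.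

Theorem theorem7p1 (R : realType) (I : set R)
    (x : R -> 'cV[R]_5) (e : R -> 'cV[R]_3)
    (u : R -> 'cV[R]_4) (r : R -> R)
    (openI : open I) (intervalI : is_interval I)
    (sol : poincare_solution I x e u r)
    (noncolliding : ~ colliding I x) :
  exists (L : 'cV[R]_5) (psi : R),
    [/\ forall t, I t -> L = Lvec (u t) (derive1 u t) (r t) (e t),
        (exists2 t, I t & e t != 0) -> L != 0,
        0 < psi <= pi / 2,
        forall t, I t ->
          cos psi = cos_aperture (u t) (derive1 u t) (r t) (e t)
      & geodesic_on (cone L psi) I x].
Proof.
have [t0 It0 v0] := noncolliding_velocity openI sol noncolliding.
pose Lt t := Lvec (u t) (derive1 u t) (r t) (e t).
pose k t := cos_aperture (u t) (derive1 u t) (r t) (e t).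
pose lambda2 t := r t ^+ 4 *
  dot (dstereo (u t) (derive1 u t)) (dstereo (u t) (derive1 u t)).
have rpos t : I t -> 0 < r t := r_gt0 sol (t := t).
have e_const t : I t -> dot (e t0) (e t0) = dot (e t) (e t).
  move=> It.
  apply: (@constant_on_interval _ I (fun s => dot (e s) (e s))) => //.
  by move=> s Is; exact: (is_derive_norm2_e sol Is).
have lambda_const t : I t -> lambda2 t0 = lambda2 t.
  move=> It; apply: (@constant_on_interval _ I lambda2) => //.
  by move=> s Is; exact: (is_derive_angular_momentum sol Is).
have L_const t : I t -> Lt t0 = Lt t.
  move=> It; apply/matrixP => i j.
  apply: (@constant_on_interval _ I (fun s => Lt s i j)) => // s Is.
  have /is_derive_mxP/(_ i j) := is_derive_Lvec sol Is.
  by rewrite mxE.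
have k_const t : I t -> k t0 = k t.
  move=> It; rewrite /k !cos_apertureE -/(lambda2 t0) -/(lambda2 t).
  by rewrite /enorm (e_const t It) (lambda_const t It).
(* Non-collision is known at t0 only; the conservation of the angular
   momentum extends it to the whole interval. *)
have v_neq0 t : I t -> derive1 u t != 0.
  move=> It; apply/eqP => vt.
  have := angular_momentum_gt0 (u t0) (rpos _ It0) v0.
  by rewrite -/(lambda2 t0) (lambda_const t It) /lambda2 vt dstereo0 dot0r mulr0
    ltxx.
have kb : 0 <= k t0 < 1 by apply: cos_aperture_ge0_lt1; [exact: rpos|].
have cosk : cos (acos (k t0)) = k t0.
  have /andP[k0 k1] := kb.
  by rewrite acosK// in_itv/= (le_trans _ k0) ?lerN10// ltW.
exists (Lt t0), (acos (k t0)); split => //.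
- move=> [t It et]; rewrite (L_const t It) -dot_eq0 dot_Lvec gt_eqF//.
  have := angular_momentum_gt0 (u t) (rpos _ It) (v_neq0 _ It).
  have : 0 < dot (e t) (e t) by rewrite dot_gt0.
  by move=> e0 l0; rewrite mulr_gt0 ?addr_gt0 ?divr_gt0.
- exact: acos_itv_pihalf.
- by move=> t It; rewrite cosk; exact: k_const.
move=> t It; have kt := etrans cosk (k_const t It).
rewrite (L_const t It) (x_stereo sol It).
have xd := is_derive_x openI sol It.
have xdd := is_derive_dx openI sol It.
split; [|by case: xd|by case: xdd|].
  by apply: cone_stereo => //; [exact: rpos|exact: v_neq0].
move=> v vt; rewrite -[derive1n 2 x t]/(derive1 (derive1 x) t).
rewrite (derive1_val xdd) dotE.
by rewrite (dot_dstereo_tangent (rpos _ It) (v_neq0 _ It) kt vt) mulr0.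
Qed.
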